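(* For each of the following pairs $(L,\ell)$ and every $\mathcal{L}(\Box,\mathbf{I})$-formula $A$, if $L\vdash A$ then $\ell\vdash A$: $(\mathbf{IL}^-(\mathbf{J5}),\ \mathbf{il}^-)$; $(\mathbf{IL}^-(\mathbf{J1}),\ \mathbf{il}^-(\mathbf{J1}^u))$; $(\mathbf{IL}^-(\mathbf{J4}_+,\mathbf{J5}),\ \mathbf{il}^-(\mathbf{I2}))$; $(\mathbf{IL}^-(\mathbf{J2}_+),\ \mathbf{il}^-(\mathbf{I2}))$; $(\mathbf{IL}^-(\mathbf{J1},\mathbf{J5}),\ \mathbf{il}^-(\mathbf{J15}^u))$; $(\mathbf{CL},\ \mathbf{il}^-(\mathbf{J1}^u,\mathbf{I2}))$; $(\mathbf{IL}^-(\mathbf{J1},\mathbf{J4}_+,\mathbf{J5}),\ \mathbf{il}^-(\mathbf{J15}^u,\mathbf{I2}))$.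
   Context: The language $\mathcal{L}(\Box,\rhd)$ consists of propositional variables, $\bot$, $\to$, unary $\Box$ and binary $\rhd$; other connectives as usual, $\Diamond A:\equiv\neg\Box\neg A$, $\mathbf{I}A:\equiv\top\rhd A$; $\mathcal{L}(\Box,\mathbf{I})$-formulas are those built from variables and $\bot$ by $\to$, $\Box$, $\mathbf{I}$. The logic $\mathbf{IL}^-$ has as axioms all tautologies, $\Box(A\to B)\to(\Box A\to\Box B)$, $\Box(\Box A\to A)\to\Box A$, $\mathbf{J3}$: $(A\rhd C)\land(B\rhd C)\to(A\lor B)\rhd C$, $\mathbf{J6}$: $\Box A\leftrightarrow(\neg A\rhd\bot)$; rules: Modus Ponens, Necessitation, from $A\to B$ infer $(C\rhd A)\to(C\rhd B)$, and from $A\to B$ infer $(B\rhd C)\to(A\rhd C)$. Schemata: $\mathbf{J1}$: $\Box(A\to B)\to A\rhd B$; $\mathbf{J2}_+$: $(A\rhd(B\lor C))\land(B\rhd C)\to A\rhd C$; $\mathbf{J4}_+$: $\Box(A\to B)\to(C\rhd A\to C\rhd B)$; $\mathbf{J5}$: $\Diamond A\rhd A$. $L(\Sigma_1,\dots,\Sigma_k)$ is $L$ with schemata $\Sigma_i$ added as axioms; $\mathbf{CL}:=\mathbf{IL}^-(\mathbf{J1},\mathbf{J2}_+)$. The logic $\mathbf{il}^-$ has as axioms all tautologies of $\mathcal{L}(\Box,\mathbf{I})$, $\Box(A\to B)\to(\Box A\to\Box B)$, $\Box(\Box A\to A)\to\Box A$, $\Box\bot\leftrightarrow\mathbf{I}\bot$;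 rules Modus Ponens, Necessitation, and from $A\to B$ infer $\mathbf{I}A\to\mathbf{I}B$. Schemata: $\mathbf{I2}$: $\Box(A\to B)\to(\mathbf{I}A\to\mathbf{I}B)$; $\mathbf{J1}^u$: $\Box A\to\mathbf{I}A$; $\mathbf{J15}^u$: $\Box(A\lor\Diamond A)\to\mathbf{I}A$. *)

(* Defs.v *)
From Stdlib Require Import Bool List.
Import ListNotations.

Inductive form : Type :=
| var (n : nat)
| bot
| imp (A B : form)
| box (A : form)
| rhd (A B : form).

Declare Scope form_scope.
Delimit Scope form_scope with form.
Bind Scope form_scope with form.
Notation "A --> B" := (imp A B) (at level 80, right associativity) : form_scope.
Notation "A |> B" := (rhd A B) (at level 60, no associativity) : form_scope.

Definition neg (A : form) : form := (A --> bot)%form.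
Definition top : form := neg bot.
Definition lor (A B : form) : form := (neg A --> B)%form.
Definition land (A B : form) : form := neg (A --> neg B)%form.
Definition equ (A B : form) : form := land (A --> B)%form (B --> A)%form.
Definition dia (A : form) : form := neg (box (neg A))%form.
Definition Imod (A : form) : form := (top |> A)%form.

(* Variables and modal formulas are the propositional atoms. *)
Fixpoint eval (v : form -> bool) (A : form) : bool :=
  match A with
  | bot => false
  | imp B C => implb (eval v B) (eval v C)
  | var _ | box _ | rhd _ _ => v A
  end.

Definition tautology (A : form) : Prop := forall v, eval v A = true.

Inductive schema : Type := J1 | J2p | J4p | J5.

Inductive instance : schema -> form -> Prop :=
| inst_J1 A B : instance J1 (box (A --> B) --> A |> B)
| inst_J2p A B C :
    instance J2p (land (A |> lor B C) (B |> C) --> A |> C)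
| inst_J4p A B C : instance J4p (box (A --> B) --> C |> A --> C |> B)
| inst_J5 A : instance J5 (dia A |> A).

(* [ILm S A]: A is a theorem of IL^-(S). *)
Inductive ILm (S : list schema) : form -> Prop :=
| ILm_taut A : tautology A -> ILm S A
| ILm_K A B : ILm S (box (A --> B) --> box A --> box B)
| ILm_L A : ILm S (box (box A --> A) --> box A)
| ILm_J3 A B C : ILm S (land (A |> C) (B |> C) --> lor A B |> C)
| ILm_J6 A : ILm S (equ (box A) (neg A |> bot))
| ILm_schema s A : In s S -> instance s A -> ILm S A
| ILm_mp A B : ILm S (A --> B) -> ILm S A -> ILm S B
| ILm_nec A : ILm S A -> ILm S (box A)
| ILm_R1 A B C : ILm S (A --> B) -> ILm S (C |> A --> C |> B)
| ILm_R2 A B C : ILm S (A --> B) -> ILm S (B |> C --> A |> C).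

Definition CL : form -> Prop := ILm [J1; J2p].

Inductive uform : Type :=
| uvar (n : nat)
| ubot
| uimp (A B : uform)
| ubox (A : uform)
| uI (A : uform).

Declare Scope uform_scope.
Delimit Scope uform_scope with uform.
Bind Scope uform_scope with uform.
Notation "A --> B" := (uimp A B) (at level 80, right associativity) : uform_scope.

Definition uneg (A : uform) : uform := (A --> ubot)%uform.
Definition udisj (A B : uform) : uform := (uneg A --> B)%uform.
Definition uconj (A B : uform) : uform := uneg (A --> uneg B)%uform.
Definition uequ (A B : uform) : uform := uconj (A --> B)%uform (B --> A)%uform.
Definition udia (A : uform) : uform := uneg (ubox (uneg A))%uform.

Fixpoint ueval (v : uform -> bool) (A : uform) : bool :=
  match A with
  | ubot => false
  | uimp B C => implb (ueval v B) (ueval v C)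
  | uvar _ | ubox _ | uI _ => v A
  end.

Definition utautology (A : uform) : Prop := forall v, ueval v A = true.

Inductive uschema : Type := I2 | J1u | J15u.

Inductive uinstance : uschema -> uform -> Prop :=
| uinst_I2 A B : uinstance I2 (ubox (A --> B) --> uI A --> uI B)
| uinst_J1u A : uinstance J1u (ubox A --> uI A)
| uinst_J15u A : uinstance J15u (ubox (udisj A (udia A)) --> uI A).

(* [ilm S A]: A is a theorem of il^-(S). *)
Inductive ilm (S : list uschema) : uform -> Prop :=
| ilm_taut A : utautology A -> ilm S A
| ilm_K A B : ilm S (ubox (A --> B) --> ubox A --> ubox B)
| ilm_L A : ilm S (ubox (ubox A --> A) --> ubox A)
| ilm_Ibot : ilm S (uequ (ubox ubot) (uI ubot))
| ilm_schema s A : In s S -> uinstance s A -> ilm S A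
| ilm_mp A B : ilm S (A --> B) -> ilm S A -> ilm S B
| ilm_nec A : ilm S A -> ilm S (ubox A)
| ilm_RI A B : ilm S (A --> B) -> ilm S (uI A --> uI B).

(* I A abbreviates top |> A, so L(Box, I)-formulas are L(Box, Rhd)-formulas
   through this (injective) embedding. *)
Fixpoint embed (A : uform) : form :=
  match A with
  | uvar n => var n
  | ubot => bot
  | uimp B C => imp (embed B) (embed C)
  | ubox B => box (embed B)
  | uI B => Imod (embed B)
  end.

(* Main.v *)
(** For each pair we translate L(Box, Rhd) into L(Box, I), reading [A |> B] as
    [Box (A -> f B) \/ I B] for a suitable [f]: [f B = Dia B] for the logics with J5
    but not J1, [f B = bot] for J2_+, [f B = B] for J1 and CL, and
    [f B = B \/ Dia B] for those with J1 and J5.  As the unary logic proves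
    [Box (f B) -> I B], the formula [top |> B] is read as [I B] up to provable
    equivalence, so the translation fixes L(Box, I); it also sends theorems of
    the binary logic to theorems of the unary one. *)
Require Import Defs.
From Stdlib Require Import List.
Import ListNotations.

Local Open Scope uform_scope.

Ltac solve_taut :=
  intros v; cbn; unfold udia, udisj, uconj, uneg; cbn;
  repeat match goal with
    | |- context [ueval v ?X] => destruct (ueval v X)
    | |- context [v ?X] => destruct (v X)
    end; reflexivity.

(** * Derived rules and theorems of the unary logics *)

Section UnaryLogic.

Variable S : list uschema.

Lemma ilm_cons1 A C : ilm S A -> utautology (A --> C) -> ilm S C.
Proof. intros HA HT. exact (ilm_mp S A C (ilm_taut S _ HT) HA). Qed.

Lemma ilm_cons2 A B C :
  ilm S A -> ilm S B -> utautology (A --> B --> C) -> ilm S C.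
Proof.
  intros HA HB HT.
  exact (ilm_mp S B C (ilm_mp S A _ (ilm_taut S _ HT) HA) HB).
Qed.

Lemma ilm_cons3 A B C D :
  ilm S A -> ilm S B -> ilm S C -> utautology (A --> B --> C --> D) -> ilm S D.
Proof.
  intros HA HB HC HT.
  exact (ilm_mp S C D (ilm_mp S B _ (ilm_mp S A _ (ilm_taut S _ HT) HA) HB) HC).
Qed.

Lemma ilm_box_mono A B : ilm S (A --> B) -> ilm S (ubox A --> ubox B).
Proof. intros H. exact (ilm_mp S _ _ (ilm_K S A B) (ilm_nec S _ H)). Qed.

Lemma ilm_box_mono2 A B C :
  ilm S (A --> B --> C) -> ilm S (ubox A --> ubox B --> ubox C).
Proof.
  intros H.
  refine (ilm_cons2 _ _ _ (ilm_box_mono _ _ H) (ilm_K S B C) _); solve_taut.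
Qed.

(** Löb's axiom for [B], the conjunction of [A] and [ubox A]: since [ubox B] yields [ubox A], the
    formula [A] implies [ubox B --> B]. *)
Lemma ilm_four A : ilm S (ubox A --> ubox (ubox A)).
Proof.
  set (B := uconj A (ubox A)).
  assert (HA : ilm S (ubox B --> ubox A)).
  { apply ilm_box_mono, ilm_taut; solve_taut. }
  assert (HBA : ilm S (ubox B --> ubox (ubox A))).
  { apply ilm_box_mono, ilm_taut; solve_taut. }
  assert (HL : ilm S (ubox A --> ubox (ubox B --> B))).
  { apply ilm_box_mono. refine (ilm_cons1 _ _ HA _); solve_taut. }
  refine (ilm_cons3 _ _ _ _ HL (ilm_L S B) HBA _); solve_taut.
Qed.

Lemma ilm_box_bot_I A : ilm S (ubox ubot --> uI A).
Proof.
  assert (H : ilm S (uI ubot --> uI A)).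
  { apply ilm_RI, ilm_taut; solve_taut. }
  refine (ilm_cons2 _ _ _ (ilm_Ibot S) H _); solve_taut.
Qed.

Lemma ilm_dia_bot : ilm S (udia ubot --> ubot).
Proof.
  assert (H : ilm S (ubox (uneg ubot))) by (apply ilm_nec, ilm_taut; solve_taut).
  refine (ilm_cons1 _ _ H _); solve_taut.
Qed.

(** [udia A] refutes [ubox ubot], that is, implies [ubox ubot --> ubot], so Löb's axiom for [ubot]
    applies. *)
Lemma ilm_box_dia A : ilm S (ubox (udia A) --> ubox ubot).
Proof.
  assert (H1 : ilm S (ubox ubot --> ubox (uneg A))).
  { apply ilm_box_mono, ilm_taut; solve_taut. }
  assert (H2 : ilm S (ubox (udia A) --> ubox (ubox ubot --> ubot))).
  { apply ilm_box_mono. refine (ilm_cons1 _ _ H1 _); solve_taut. }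
  refine (ilm_cons2 _ _ _ H2 (ilm_L S ubot) _); solve_taut.
Qed.

(** Transitivity keeps [ubox (A --> B)] available under the box, where contraposition turns it into
    [udia A --> udia B]. *)
Lemma ilm_dia_box_mono A B :
  ilm S (ubox (A --> B) --> ubox (udia A --> udia B)).
Proof.
  assert (H1 : ilm S (ubox (A --> B) --> ubox (uneg B) --> ubox (uneg A))).
  { apply ilm_box_mono2, ilm_taut; solve_taut. }
  assert (H2 : ilm S (ubox (ubox (A --> B)) --> ubox (udia A --> udia B))).
  { apply ilm_box_mono. refine (ilm_cons1 _ _ H1 _); solve_taut. }
  refine (ilm_cons2 _ _ _ (ilm_four (A --> B)) H2 _); solve_taut.
Qed.

Lemma ilm_I2 A B : In I2 S -> ilm S (ubox (A --> B) --> uI A --> uI B).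
Proof. intros H. exact (ilm_schema S I2 _ H (uinst_I2 A B)). Qed.

End UnaryLogic.

(** * The translation and its soundness *)

Fixpoint translate (f : uform -> uform) (A : form) : uform :=
  match A with
  | var n => uvar n
  | bot => ubot
  | imp B C => translate f B --> translate f C
  | box B => ubox (translate f B)
  | rhd B C =>
      udisj (ubox (translate f B --> f (translate f C))) (uI (translate f C))
  end.

(** Valuations pull back along the translation, so tautologies are sent to tautologies. *)
Lemma ueval_translate f v A :
  ueval v (translate f A) = eval (fun B => ueval v (translate f B)) A.
Proof. induction A; cbn; congruence. Qed.

(** [adm_mono] serves monotonicity in the right argument, [adm_bot] serves J6, and [adm_I] makes the
    translation fix [uI] up to equivalence. *)
Record admissible (S : list uschema) (f : uform -> uform) : Prop := {
  adm_mono A B : ilm S (ubox (A --> B) --> ubox (f A --> f B));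
  adm_bot : ilm S (f ubot --> ubot);
  adm_I A : ilm S (ubox (f A) --> uI A) }.

Section Translation.

Variables (S : list uschema) (f : uform -> uform).
Hypothesis Hf : admissible S f.

Local Notation tr := (translate f).

Lemma translate_embed A :
  ilm S (tr (embed A) --> A) /\ ilm S (A --> tr (embed A)).
Proof.
  induction A as [n| |A [A1 A2] B [B1 B2]|A [A1 A2]|A [A1 A2]]; cbn.
  1,2: split; apply ilm_taut; solve_taut.
  - split.
    + refine (ilm_cons2 _ _ _ _ A2 B1 _); solve_taut.
    + refine (ilm_cons2 _ _ _ _ A1 B2 _); solve_taut.
  - split; apply ilm_box_mono; assumption.
  - split.
    (* With left argument [top] the boxed disjunct collapses to [ubox (f _)], which [adm_I] absorbs
       into the other disjunct. *)
    + assert (H : ilm S (ubox (uneg ubot --> f (tr (embed A)))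
                           --> ubox (f (tr (embed A))))).
      { apply ilm_box_mono, ilm_taut; solve_taut. }
      refine (ilm_cons3 _ _ _ _ _ H (adm_I _ _ Hf (tr (embed A)))
                (ilm_RI _ _ _ A1) _); solve_taut.
    + refine (ilm_cons1 _ _ _ (ilm_RI _ _ _ A2) _); solve_taut.
Qed.

(** The disjunct [uI (tr C)] does not depend on the left argument, so only the boxed disjuncts have
    to be combined. *)
Lemma translate_J3 A B C :
  ilm S (tr (imp (land (rhd A C) (rhd B C)) (rhd (lor A B) C))).
Proof.
  assert (H : ilm S (ubox (tr A --> f (tr C)) --> ubox (tr B --> f (tr C))
                       --> ubox (udisj (tr A) (tr B) --> f (tr C)))).
  { apply ilm_box_mono2, ilm_taut; solve_taut. }
  refine (ilm_cons1 _ _ _ H _); solve_taut.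
Qed.

Lemma translate_J6 A : ilm S (tr (equ (box A) (rhd (neg A) bot))).
Proof.
  assert (H1 : ilm S (ubox (tr A) --> ubox (uneg (tr A) --> f ubot))).
  { apply ilm_box_mono, ilm_taut; solve_taut. }
  assert (H2 : ilm S (ubox (uneg (tr A) --> f ubot) --> ubox (tr A))).
  { apply ilm_box_mono. refine (ilm_cons1 _ _ _ (adm_bot _ _ Hf) _); solve_taut. }
  (* The disjunct [uI ubot] is harmless: it is equivalent to [ubox ubot]. *)
  assert (H3 : ilm S (uI ubot --> ubox (tr A))).
  { assert (H : ilm S (ubox ubot --> ubox (tr A))).
    { apply ilm_box_mono, ilm_taut; solve_taut. }
    refine (ilm_cons2 _ _ _ _ (ilm_Ibot S) H _); solve_taut. }
  refine (ilm_cons3 _ _ _ _ _ H1 H2 H3 _); solve_taut.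
Qed.

Lemma translate_rhd_mono_r A B C :
  ilm S (ubox (A --> B) --> ubox (C --> f A) --> ubox (C --> f B)).
Proof.
  assert (H : ilm S (ubox (f A --> f B) --> ubox (C --> f A) --> ubox (C --> f B))).
  { apply ilm_box_mono2, ilm_taut; solve_taut. }
  refine (ilm_cons2 _ _ _ _ (adm_mono _ _ Hf A B) H _); solve_taut.
Qed.

Lemma translate_sound (L : list schema) :
  (forall s A, In s L -> instance s A -> ilm S (tr A)) ->
  forall A, ILm L A -> ilm S (tr A).
Proof.
  intros HL A HA.
  induction HA as [A HT|A B|A|A B C|A|s A Hs HA|A B _ IH1 _ IH2|A _ IH
                  |A B C _ IH|A B C _ IH].
  - apply ilm_taut. intros v. rewrite ueval_translate. apply HT.
  - apply ilm_K.
  - apply ilm_L.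
  - apply translate_J3.
  - apply translate_J6.
  - exact (HL s A Hs HA).
  - exact (ilm_mp _ _ _ IH1 IH2).
  - exact (ilm_nec _ _ IH).
  - change (ilm S (tr A --> tr B)) in IH.
    refine (ilm_cons3 _ _ _ _ _ (ilm_nec _ _ IH)
              (translate_rhd_mono_r (tr A) (tr B) (tr C)) (ilm_RI _ _ _ IH) _);
      solve_taut.
  - change (ilm S (tr A --> tr B)) in IH.
    assert (H : ilm S (ubox (tr B --> f (tr C)) --> ubox (tr A --> f (tr C)))).
    { apply ilm_box_mono. refine (ilm_cons1 _ _ _ IH _); solve_taut. }
    refine (ilm_cons1 _ _ _ H _); solve_taut.
Qed.

Lemma translate_conservative (L : list schema) :
  (forall s A, In s L -> instance s A -> ilm S (tr A)) ->
  forall A, ILm L (embed A) -> ilm S A.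
Proof.
  intros HL A HA.
  exact (ilm_mp _ _ _ (proj1 (translate_embed A)) (translate_sound L HL _ HA)).
Qed.

(** * Conditions on [f] that validate each schema *)

Lemma translate_J1 :
  (forall A, ilm S (A --> f A)) -> forall A, instance J1 A -> ilm S (tr A).
Proof.
  intros Hext D HD. inversion HD as [A B| | |]; subst.
  assert (H : ilm S (ubox (tr A --> tr B) --> ubox (tr A --> f (tr B)))).
  { apply ilm_box_mono. refine (ilm_cons1 _ _ _ (Hext (tr B)) _); solve_taut. }
  refine (ilm_cons1 _ _ _ H _); solve_taut.
Qed.

Lemma translate_J2p :
  In I2 S -> (forall A, ilm S (f A --> A)) ->
  forall A, instance J2p A -> ilm S (tr A).
Proof.
  intros HI Hred D HD. inversion HD as [|A B C| |]; subst.
  set (a := tr A); set (b := tr B); set (c := tr C).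
  (* As [f c] implies [c], the second premise lets [udisj b c] be replaced by [c], both inside [uI]
     by I2 and inside [f] by monotonicity. *)
  assert (H1 : ilm S (ubox (b --> f c) --> ubox (udisj b c --> c))).
  { apply ilm_box_mono. refine (ilm_cons1 _ _ _ (Hred c) _); solve_taut. }
  change (ilm S (uconj (udisj (ubox (a --> f (udisj b c))) (uI (udisj b c)))
                       (udisj (ubox (b --> f c)) (uI c))
                   --> udisj (ubox (a --> f c)) (uI c))).
  refine (ilm_cons3 _ _ _ _ _ H1 (ilm_I2 S (udisj b c) c HI)
            (translate_rhd_mono_r (udisj b c) c a) _); solve_taut.
Qed.

Lemma translate_J4p : In I2 S -> forall A, instance J4p A -> ilm S (tr A).
Proof.
  intros HI D HD. inversion HD as [| |A B C|]; subst.
  refine (ilm_cons2 _ _ _ _ (ilm_I2 S (tr A) (tr B) HI)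
            (translate_rhd_mono_r (tr A) (tr B) (tr C)) _); solve_taut.
Qed.

(** Necessitation of the assumption is already the boxed disjunct. *)
Lemma translate_J5 :
  (forall A, ilm S (udia A --> f A)) -> forall A, instance J5 A -> ilm S (tr A).
Proof.
  intros Hdia D HD. inversion HD as [| | |A]; subst.
  refine (ilm_cons1 _ _ _ (ilm_nec _ _ (Hdia (tr A))) _); solve_taut.
Qed.

End Translation.

(** * Admissibility of the four choices of [f] *)

Lemma admissible_dia S : admissible S udia.
Proof.
  split.
  - apply ilm_dia_box_mono.
  - apply ilm_dia_bot.
  (* [ubox (udia A)] collapses to [ubox ubot], which implies every [uI A]. *)
  - intros A.
    refine (ilm_cons2 _ _ _ _ (ilm_box_dia S A) (ilm_box_bot_I S A) _); solve_taut.
Qed.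

Lemma admissible_bot S : admissible S (fun _ => ubot).
Proof.
  split.
  - intros A B.
    assert (H : ilm S (ubox (ubot --> ubot))) by (apply ilm_nec, ilm_taut; solve_taut).
    refine (ilm_cons1 _ _ _ H _); solve_taut.
  - apply ilm_taut; solve_taut.
  - apply ilm_box_bot_I.
Qed.

Lemma admissible_id S : In J1u S -> admissible S (fun A => A).
Proof.
  intros HJ. split.
  - intros A B. apply ilm_taut; solve_taut.
  - apply ilm_taut; solve_taut.
  - intros A. exact (ilm_schema S J1u _ HJ (uinst_J1u A)).
Qed.

Lemma admissible_disj_dia S : In J15u S -> admissible S (fun A => udisj A (udia A)).
Proof.
  intros HJ. split.
  - intros A B.
    assert (H : ilm S (ubox (A --> B) --> ubox (udia A --> udia B)
                         --> ubox (udisj A (udia A) --> udisj B (udia B)))).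
    { apply ilm_box_mono2, ilm_taut; solve_taut. }
    refine (ilm_cons2 _ _ _ _ H (ilm_dia_box_mono S A B) _); solve_taut.
  - refine (ilm_cons1 _ _ _ (ilm_dia_bot S) _); solve_taut.
  - intros A. exact (ilm_schema S J15u _ HJ (uinst_J15u A)).
Qed.

Theorem theorem4p9 :
  forall A : uform,
    (ILm [J5] (embed A) -> ilm [] A) /\
    (ILm [J1] (embed A) -> ilm [J1u] A) /\
    (ILm [J4p; J5] (embed A) -> ilm [I2] A) /\
    (ILm [J2p] (embed A) -> ilm [I2] A) /\
    (ILm [J1; J5] (embed A) -> ilm [J15u] A) /\
    (CL (embed A) -> ilm [J1u; I2] A) /\
    (ILm [J1; J4p; J5] (embed A) -> ilm [J15u; I2] A).
Proof.
  intros A.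
  pose (f := fun B => udisj B (udia B)).
  repeat split.
  1: apply (translate_conservative [] udia); [apply admissible_dia|].
  2: apply (translate_conservative [J1u] (fun B => B));
       [apply admissible_id; cbn; tauto|].
  3: apply (translate_conservative [I2] udia); [apply admissible_dia|].
  4: apply (translate_conservative [I2] (fun _ => ubot)); [apply admissible_bot|].
  5: apply (translate_conservative [J15u] f);
       [apply admissible_disj_dia; cbn; tauto|].
  6: apply (translate_conservative [J1u; I2] (fun B => B));
       [apply admissible_id; cbn; tauto|].
  7: apply (translate_conservative [J15u; I2] f);
       [apply admissible_disj_dia; cbn; tauto|].
  (* One goal per schema of each binary logic; the side conditions left are membership of I2,
     admissibility, and implications between [A], [udia A] and [f A] that are tautologies. *)
  all: intros s D Hs; cbn in Hs;
    repeat (destruct Hs as [<-|Hs]; [|]); try contradiction;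
    revert D;
    first [ apply translate_J1 | apply translate_J2p
          | apply translate_J4p | apply translate_J5 ];
    try (cbn; tauto);
    first [ apply admissible_dia
          | apply admissible_disj_dia; cbn; tauto
          | apply admissible_bot
          | apply admissible_id; cbn; tauto
          | intros B; apply ilm_taut; solve_taut ].
Qed.
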